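(* Let $D_1=\{(a,b): a,b>0,\ ab\le 1/4\}$ and $D_2=\{(a,b): a,b>0,\ 1/a+1/b\le 4\}$, and let $(a,b)\neq(1/2,1/2)$. For each $r\in(0,1)$ and $(a,b)\in D_1$, $$1<\frac{(1+r)F(a,b;a+b;r^2)}{F(a,b;a+b;4r/(1+r)^2)}<\frac{B(a,b)}{\pi}.$$ For each $r\in(0,1)$ and $(a,b)\in D_2$ the inequalities are reversed: $$\frac{B(a,b)}{\pi}<\frac{(1+r)F(a,b;a+b;r^2)}{F(a,b;a+b;4r/(1+r)^2)}<1.$$
   Context: For real $a,b,c$ with $c\ne 0,-1,-2,\dots$, the Gaussian hypergeometric function is $F(a,b;c;x)=\sum_{n=0}^\infty \frac{(a,n)(b,n)}{(c,n)}\frac{x^n}{n!}$ for $x\in(-1,1)$, where $(a,n)=a(a+1)\cdots(a+n-1)$ for $n\ge 1$ and $(a,0)=1$. $B(a,b)=\Gamma(a)\Gamma(b)/\Gamma(a+b)$ is the classical beta function. Here $a,b$ are real numbers. *)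

(* Defs.v *)
From Stdlib Require Import Factorial Reals.
From Coquelicot Require Import Coquelicot.

Open Scope R_scope.

Fixpoint pochhammer (a : R) (n : nat) : R :=
  match n with
  | O => 1
  | S m => pochhammer a m * (a + INR m)
  end.

(* Meaningful for c <> 0, -1, -2, ... and -1 < x < 1, where the series
   converges; total elsewhere, with unspecified values. *)
Definition hypergeom (a b c x : R) : R :=
  PSeries (fun n => pochhammer a n * pochhammer b n
                    / (pochhammer c n * INR (fact n))) x.

(* Euler's integral, improper at both ends (at 0 when x < 1); meaningful for
   x > 0, where it converges. *)
Definition Gamma (x : R) : R :=
  RInt_gen (fun t => Rpower t (x - 1) * exp (- t))
           (at_right 0) (Rbar_locally p_infty).

Definition Beta (a b : R) : R := Gamma a * Gamma b / Gamma (a + b).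

Definition D1 (a b : R) : Prop := 0 < a /\ 0 < b /\ a * b <= 1 / 4.

Definition D2 (a b : R) : Prop := 0 < a /\ 0 < b /\ 1 / a + 1 / b <= 4.

Definition landen_ratio (a b r : R) : R :=
  (1 + r) * hypergeom a b (a + b) (r ^ 2)
  / hypergeom a b (a + b) (4 * r / (1 + r) ^ 2).

(* Main.v *)
Require Import Defs.
From Stdlib Require Import Factorial Reals Lra Lia Classical.
From Coquelicot Require Import Coquelicot.

Open Scope R_scope.

(** Let [A] be the power series F(a,b;a+b;x) and [C] the power series
    F(1/2,1/2;1;x).  For [C] Landen's transformation is the exact identity
    (1+r) C(r^2) = C(4r/(1+r)^2) ([landen_identity]); hence, with g = A/C,
    the quantity to be estimated is g(r^2) / g(4r/(1+r)^2), and the theorem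
    becomes a statement on g at two points 0 < r^2 < 4r/(1+r)^2 < 1.

    The ratio of the n-th coefficients of [A] and [C] starts at 1 and tends to
    pi/B(a,b) ([coef_ratio_limit]).  The sign of its increments is the sign of
    (ab - 1/4) n + (ab - (a+b)/4) ([zb_coef_cross]): negative when (a,b) is
    in D1, nonnegative and eventually positive when (a,b) is in D2.  If the
    ratios of coefficients of two power series decrease, so does the ratio of
    their sums ([PSeries_ratio_decreasing]).  So in D1 the function g decreases
    strictly on (0,1) and lies strictly between pi/B(a,b) and 1.  Monotonicity gives the
    lower bound 1, and the two outer bounds on g give B(a,b)/pi.  In D2 the
    roles of [A] and [C] are exchanged.

    Three facts feed this argument.  Landen's identity: both of its sides,
    divided by 1+r, solve (r(1-r^2)y')' = ry, which is singular at 0; a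
    Wronskian argument leaves only one solution regular there, up to a
    constant factor.  Gauss's limit for the Gamma integral
    ([is_lim_seq_gauss]), which makes n times the n-th coefficient of [A] tend
    to 1/B(a,b); it follows from the functional equation and a one-step
    convexity bound.  And Wallis's formula ([wallis_limit]), which is the same limit
    for [C] with the value 1/pi. *)

(** * Power series whose coefficients have a monotone ratio *)

Lemma CV_radius_ge_1 (a : nat -> R) (M x : R) :
  (forall n, Rabs (a n) <= M) -> -1 < x < 1 -> Rbar_lt (Rabs x) (CV_radius a).
Proof.
  intros HM Hx.
  apply Rbar_lt_le_trans with 1; [simpl; apply Rabs_def1; lra|].
  apply (proj1 (CV_radius_bounded a)). exists M. intros n.
  rewrite pow1, Rmult_1_r. apply HM.
Qed.

Lemma term_le_Series (u : nat -> R) (k : nat) :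
  (forall n, 0 <= u n) -> ex_series u -> u k <= Series u.
Proof.
  intros Hu He. apply Rle_trans with (sum_n u k).
  - destruct k as [|k]; [rewrite sum_O; lra|].
    rewrite sum_Sn. unfold plus; simpl.
    assert (0 <= sum_n u k); [|lra].
    induction k as [|k IH]; [rewrite sum_O; auto|].
    rewrite sum_Sn. unfold plus; simpl. specialize (Hu (S k)). lra.
  - apply (is_lim_seq_incr_compare (sum_n u)).
    + apply Series_correct, He.
    + intros n. rewrite sum_Sn. unfold plus; simpl. specialize (Hu (S n)). lra.
Qed.

Lemma Series_lt (u v : nat -> R) (k : nat) :
  ex_series u -> ex_series v ->
  (forall n, u n <= v n) -> u k < v k -> Series u < Series v.
Proof.
  intros Hu Hv Hle Hk.
  assert (H := term_le_Series (fun n => v n - u n) k).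
  rewrite Series_minus in H by assumption.
  assert (v k - u k <= Series v - Series u); [|lra].
  apply H.
  - intros n. specialize (Hle n). lra.
  - apply (ex_series_minus (V:=R_NormedModule)); assumption.
Qed.

Lemma PSeries_lt (p q : nat -> R) (x : R) (k : nat) :
  0 < x -> ex_pseries p x -> ex_pseries q x ->
  (forall n, p n <= q n) -> p k < q k -> PSeries p x < PSeries q x.
Proof.
  intros Hx Hp Hq Hle Hk. apply (Series_lt _ _ k).
  - apply ex_pseries_R, Hp.
  - apply ex_pseries_R, Hq.
  - intros n. apply Rmult_le_compat_r; [apply pow_le; lra | apply Hle].
  - apply Rmult_lt_compat_r; [apply pow_lt; lra | exact Hk].
Qed.

Lemma ex_pseries_bounded (p : nat -> R) (M x : R) :
  (forall n, 0 < p n <= M) -> 0 < x < 1 -> ex_pseries p x.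
Proof.
  intros HM Hx. apply CV_radius_inside, (CV_radius_ge_1 p M); [|lra].
  intros n. specialize (HM n). rewrite Rabs_pos_eq; lra.
Qed.

Lemma PSeries_pos (p : nat -> R) (x : R) :
  (forall n, 0 < p n) -> 0 <= x -> ex_pseries p x -> 0 < PSeries p x.
Proof.
  intros Hp Hx Hex. apply Rlt_le_trans with (p 0%nat * x ^ 0).
  - simpl. specialize (Hp 0%nat). lra.
  - apply (term_le_Series (fun n => p n * x ^ n) 0).
    + intros n. apply Rmult_le_pos; [left; apply Hp | apply pow_le; lra].
    + apply ex_pseries_R, Hex.
Qed.

Lemma ratio_decreasing (p q : nat -> R) :
  (forall n, 0 < q n) ->
  (forall n, p (S n) * q n <= p n * q (S n)) ->
  forall n m, (n <= m)%nat -> p m / q m <= p n / q n.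
Proof.
  intros Hq Hstep n m Hnm. induction Hnm as [|m Hnm IH]; [lra|].
  eapply Rle_trans; [|exact IH].
  apply Rle_div_l; [apply Hq|].
  replace (p m / q m * q (S m)) with (p m * q (S m) / q m) by (field; apply Rgt_not_eq, Hq).
  apply Rle_div_r; [apply Hq|]. apply Hstep.
Qed.

(** Let [l] be the value of P/Q at x.  The coefficients d n = p n - l * q n
    change sign once, from nonnegative to negative, at some index N, and
    the sum of the d n * x^n is 0.  Passing from x to y multiplies the n-th term
    by (y/x)^n; replacing this factor by (y/x)^N raises the sum, because
    the terms before N are nonnegative and the others negative.  So the
    sum of the d n * y^n is negative, which is the claim. *)
Lemma PSeries_ratio_decreasing (p q : nat -> R) (x y : R) (k : nat) :
  0 < x < y ->
  ex_pseries p x -> ex_pseries q x -> ex_pseries p y -> ex_pseries q y ->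
  (forall n, 0 < q n) ->
  (forall n, p (S n) * q n <= p n * q (S n)) ->
  p (S k) * q k < p k * q (S k) ->
  PSeries p y * PSeries q x < PSeries p x * PSeries q y.
Proof.
  intros Hxy Hpx Hqx Hpy Hqy Hq Hstep Hk.
  assert (Hmono := ratio_decreasing p q Hq Hstep).
  assert (HQ : 0 < PSeries q x) by (apply PSeries_pos; [exact Hq | lra | exact Hqx]).
  set (l := PSeries p x / PSeries q x).
  set (d := fun n => p n - l * q n).
  assert (Hd : forall z, ex_pseries p z -> ex_pseries q z ->
    ex_series (fun n => d n * z ^ n) /\
    Series (fun n => d n * z ^ n) = PSeries p z - l * PSeries q z).
  { intros z Hp Hq'. apply ex_pseries_R in Hp, Hq'.
    assert (Hl := ex_series_scal_l (K:=R_AbsRing) l _ Hq').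
    assert (E : forall n, p n * z ^ n - l * (q n * z ^ n) = d n * z ^ n)
      by (intros n; unfold d; ring).
    split.
    - apply (ex_series_ext _ _ E), (ex_series_minus (V:=R_NormedModule) _ _ Hp Hl).
    - rewrite <- (Series_ext _ _ E), Series_minus, Series_scal_l by assumption.
      reflexivity. }
  destruct (Hd x Hpx Hqx) as [Hdx Ex]. destruct (Hd y Hpy Hqy) as [Hdy Ey].
  assert (Ex0 : Series (fun n => d n * x ^ n) = 0).
  { rewrite Ex. unfold l. field. lra. }
  assert (Hsgn : forall n, 0 <= d n <-> l <= p n / q n).
  { intros n. specialize (Hq n). unfold d. split; intros H.
    - apply (Rle_div_r l (p n) (q n)); lra.
    - apply (Rle_div_r l (p n) (q n)) in H; lra. }
  (* Otherwise every term of the zero sum vanishes, so [p / q] is the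
     constant [l] at k and k + 1, against the strict step. *)
  assert (HN : exists N, d N < 0).
  { destruct (classic (exists N, d N < 0)) as [H|H]; [exact H|exfalso].
    assert (Hpos : forall n, 0 <= d n)
      by (intros n; apply Rnot_lt_le; intros Hn; apply H; exists n; exact Hn).
    assert (Hterm : forall n, 0 <= d n * x ^ n)
      by (intros n; apply Rmult_le_pos; [apply Hpos | apply pow_le; lra]).
    assert (Hz : d k = 0).
    { assert (T := term_le_Series _ k Hterm Hdx). simpl in T. rewrite Ex0 in T.
      assert (0 < x ^ k) by (apply pow_lt; lra). specialize (Hpos k). nra. }
    specialize (Hpos (S k)). unfold d in *. pose proof (Hq k). pose proof (Hq (S k)). nra. }
  destruct (classic (exists N, d N < 0 /\ forall n, (n < N)%nat -> 0 <= d n))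
    as [(N & HNneg & HNpos)|HNo].
  2:{ exfalso. destruct HN as [N HN]. revert HN.
      induction N as [N IH] using (well_founded_induction Wf_nat.lt_wf).
      intros HN. apply HNo. exists N. split; [exact HN|].
      intros n Hn. apply Rnot_lt_le. intros H. exact (IH n Hn H). }
  assert (HNneg' : forall n, (N <= n)%nat -> d n < 0).
  { intros n Hn. apply Rnot_le_lt. intros H. apply Hsgn in H.
    specialize (Hmono N n Hn).
    assert (0 <= d N); [apply Hsgn; lra|lra]. }
  set (c := y / x).
  assert (Hc : 1 < c) by (unfold c; apply Rlt_div_r; lra).
  assert (Hyc : forall n, y ^ n = c ^ n * x ^ n).
  { intros n. rewrite <- Rpow_mult_distr. f_equal. unfold c. field. lra. }
  assert (Hlt : Series (fun n => d n * y ^ n) < Series (fun n => c ^ N * (d n * x ^ n))).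
  { apply (Series_lt _ _ (S N)).
    - exact Hdy.
    - exact (ex_series_scal_l (K:=R_AbsRing) (c ^ N) _ Hdx).
    - intros n. rewrite Hyc.
      assert (Hx0 : 0 < x ^ n) by (apply pow_lt; lra).
      destruct (Nat.lt_ge_cases n N) as [Hn|Hn].
      + specialize (HNpos n Hn). assert (c ^ n <= c ^ N) by (apply Rle_pow; [lra|lia]).
        assert (0 <= d n * x ^ n) by (apply Rmult_le_pos; lra). nra.
      + specialize (HNneg' n Hn). assert (c ^ N <= c ^ n) by (apply Rle_pow; [lra|lia]).
        assert (0 < - d n * x ^ n) by (apply Rmult_lt_0_compat; lra). nra.
    - rewrite Hyc. assert (Hx0 : 0 < x ^ (S N)) by (apply pow_lt; lra).
      specialize (HNneg' (S N) ltac:(lia)).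
      assert (c ^ N < c ^ (S N)) by (apply Rlt_pow; [lra|lia]).
      assert (0 < - d (S N) * x ^ (S N)) by (apply Rmult_lt_0_compat; lra). nra. }
  rewrite Series_scal_l, Ex0, Ey in Hlt.
  apply Rlt_le_trans with (l * PSeries q y * PSeries q x).
  - apply Rmult_lt_compat_r; lra.
  - right. unfold l. field. lra.
Qed.

Lemma coef_ratio_bounds (p q : nat -> R) (l : R) :
  (forall n, 0 < q n) ->
  (forall n, p (S n) * q n <= p n * q (S n)) ->
  is_lim_seq (fun n => p n / q n) l -> p 0%nat = q 0%nat ->
  forall n, l * q n <= p n <= q n.
Proof.
  intros Hq Hstep Hlim H0 n.
  assert (Hmono := ratio_decreasing p q Hq Hstep).
  split.
  - apply Rle_div_r; [apply Hq|].
    apply (is_lim_seq_decr_compare (fun n => p n / q n) l Hlim).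
    intros m. apply Hmono. lia.
  - rewrite <- (Rmult_1_l (q n)). apply Rle_div_l; [apply Hq|].
    replace 1 with (p 0%nat / q 0%nat) by (rewrite H0; field; apply Rgt_not_eq, Hq).
    apply Hmono. lia.
Qed.

Lemma PSeries_ratio_bounds (p q : nat -> R) (l x : R) (k : nat) :
  0 < x -> ex_pseries p x -> ex_pseries q x ->
  (forall n, 0 < q n) ->
  (forall n, p (S n) * q n <= p n * q (S n)) ->
  p (S k) * q k < p k * q (S k) ->
  is_lim_seq (fun n => p n / q n) l -> p 0%nat = q 0%nat ->
  l * PSeries q x < PSeries p x < PSeries q x.
Proof.
  intros Hx Hp Hqx Hq Hstep Hk Hlim H0.
  assert (B := coef_ratio_bounds p q l Hq Hstep Hlim H0).
  pose proof (B k). pose proof (B (S k)). pose proof (Hq k). pose proof (Hq (S k)).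
  split.
  - rewrite <- PSeries_scal. apply (PSeries_lt _ _ x k Hx).
    + apply ex_pseries_scal; [intros; apply Rmult_comm | exact Hqx].
    + exact Hp.
    + intros n. unfold PS_scal, scal; simpl; unfold mult; simpl. apply B.
    + unfold PS_scal, scal; simpl; unfold mult; simpl. nra.
  - apply (PSeries_lt _ _ x (S k) Hx Hp Hqx); [apply B | nra].
Qed.

(** All that the theorem needs from a pair of power series, so that it can be
    applied with the two hypergeometric series in either order. *)
Lemma power_series_comparison (p q : nat -> R) (l Mp Mq s t : R) (k : nat) :
  0 < s < t -> t < 1 ->
  (forall n, 0 < p n <= Mp) -> (forall n, 0 < q n <= Mq) ->
  (forall n, p (S n) * q n <= p n * q (S n)) ->
  p (S k) * q k < p k * q (S k) ->
  is_lim_seq (fun n => p n / q n) l -> p 0%nat = q 0%nat ->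
  PSeries p t * PSeries q s < PSeries p s * PSeries q t /\
  PSeries p s < PSeries q s /\ l * PSeries q t < PSeries p t.
Proof.
  intros Hst Ht1 HMp HMq Hstep Hk Hlim H0.
  assert (Hps : ex_pseries p s) by (apply (ex_pseries_bounded _ _ _ HMp); lra).
  assert (Hpt : ex_pseries p t) by (apply (ex_pseries_bounded _ _ _ HMp); lra).
  assert (Hqs : ex_pseries q s) by (apply (ex_pseries_bounded _ _ _ HMq); lra).
  assert (Hqt : ex_pseries q t) by (apply (ex_pseries_bounded _ _ _ HMq); lra).
  assert (Hq : forall n, 0 < q n) by (intros n; apply HMq).
  split; [|split].
  - apply (PSeries_ratio_decreasing p q s t k); assumption.
  - apply (PSeries_ratio_bounds p q l s k); assumption || lra.
  - apply (PSeries_ratio_bounds p q l t k); assumption || lra.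
Qed.

(** * The Gamma integral and Gauss's limit *)

Lemma pochhammer_pos (a : R) (n : nat) : 0 < a -> 0 < pochhammer a n.
Proof.
  intros Ha. induction n as [|n IH]; simpl; [lra|].
  apply Rmult_lt_0_compat; [exact IH|]. pose proof (pos_INR n). lra.
Qed.

Lemma is_lim_seq_inv_INR : is_lim_seq (fun n => / INR n) 0.
Proof.
  apply (is_lim_seq_inv (fun n => INR n) p_infty); [apply is_lim_seq_INR|discriminate].
Qed.

Notation is_improper f := (is_RInt_gen f (at_right 0) (Rbar_locally p_infty)).

Lemma improper_domain (P : R * R -> Prop) :
  (forall u v, 0 < u <= v -> P (u, v)) ->
  filter_prod (at_right 0) (Rbar_locally p_infty) P.
Proof.
  intros HP.
  exists (fun u => 0 < u < 1) (fun v => 1 < v).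
  - exists (mkposreal 1 Rlt_0_1). intros u Hu Hu0.
    unfold ball in Hu; simpl in Hu; unfold AbsRing_ball, abs, minus, plus, opp in Hu;
      simpl in Hu. apply Rabs_lt_between in Hu. lra.
  - exists 1. auto.
  - intros u v Hu Hv. apply HP. lra.
Qed.

(** The integrals over compact subintervals grow with the interval, so
    the improper integral is their supremum. *)
Lemma ex_improper_of_bounded (f : R -> R) (M : R) :
  (forall t, 0 < t -> continuous f t) ->
  (forall t, 0 < t -> 0 <= f t) ->
  (forall u v, 0 < u <= v -> RInt f u v <= M) ->
  ex_RInt_gen f (at_right 0) (Rbar_locally p_infty).
Proof.
  intros Hc Hpos Hb.
  assert (Hex : forall u v, 0 < u -> 0 < v -> ex_RInt f u v).
  { intros u v Hu Hv. apply (ex_RInt_continuous (V:=R_CompleteNormedModule)).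
    intros z Hz. apply Hc. revert Hz. unfold Rmin. destruct (Rle_dec u v); lra. }
  destruct (completeness (fun y => exists u v, 0 < u <= v /\ y = RInt f u v))
    as [l [Hub Hlub]].
  - exists M. intros y (u & v & H & ->). auto.
  - exists (RInt f 1 1), 1, 1. split; [lra | reflexivity].
  - exists l. intros P [eps HP].
    destruct (classic
      (exists u v, 0 < u <= v /\ l - eps < RInt f u v)) as [(u0 & v0 & H0 & Hl)|Hn].
    2:{ exfalso. assert (l <= l - eps).
        { apply Hlub. intros y (u & v & H & ->). apply Rnot_lt_le. intros Hlt.
          apply Hn. exists u, v. auto. }
        destruct eps; simpl in *; lra. }
    exists (fun u => 0 < u < u0) (fun v => v0 < v).
    + assert (H0' : 0 < u0) by lra.
      exists (mkposreal u0 H0'). intros u Hu Hu0.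
      unfold ball in Hu; simpl in Hu;
        unfold AbsRing_ball, abs, minus, plus, opp in Hu; simpl in Hu.
      apply Rabs_lt_between in Hu. lra.
    + exists v0. auto.
    + intros u v Hu Hv. simpl.
      exists (RInt f u v). split.
      { apply (RInt_correct (V:=R_CompleteNormedModule)). apply Hex; lra. }
      apply HP.
      assert (E1 : RInt f u v = RInt f u u0 + RInt f u0 v0 + RInt f v0 v).
      { rewrite <- (RInt_Chasles (V:=R_CompleteNormedModule) f u u0 v) by (apply Hex; lra).
        rewrite <- (RInt_Chasles (V:=R_CompleteNormedModule) f u0 v0 v) by (apply Hex; lra).
        unfold plus; simpl. ring. }
      assert (0 <= RInt f u u0).
      { apply RInt_ge_0; [lra| apply Hex; lra | intros; apply Hpos; lra]. }
      assert (0 <= RInt f v0 v).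
      { apply RInt_ge_0; [lra| apply Hex; lra | intros; apply Hpos; lra]. }
      assert (RInt f u v <= l).
      { apply Hub. exists u, v. split; [lra | reflexivity]. }
      unfold ball; simpl; unfold AbsRing_ball, abs, minus, plus, opp; simpl.
      apply Rabs_lt_between. destruct eps as [e He]; simpl in *; lra.
Qed.

Definition gamma_integrand (x t : R) : R := Rpower t (x - 1) * exp (- t).

Lemma Rpower_pos (t y : R) : 0 < Rpower t y.
Proof. apply exp_pos. Qed.

Lemma is_derive_Rpower (t y : R) :
  0 < t -> is_derive (fun s => Rpower s y) t (y * Rpower t (y - 1)).
Proof. intros Ht. apply is_derive_Reals, derivable_pt_lim_power, Ht. Qed.

Lemma continuous_gamma_integrand (x t : R) :
  0 < t -> continuous (gamma_integrand x) t.
Proof.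
  intros Ht. apply (continuous_mult (fun t => Rpower t (x - 1)) (fun t => exp (- t))).
  - apply (ex_derive_continuous (V:=R_NormedModule)).
    eexists. apply is_derive_Rpower, Ht.
  - apply (ex_derive_continuous (V:=R_NormedModule)). auto_derive. auto.
Qed.

(** The constant is the maximum of the left-hand side over 1 + t > 0,
    reached at 1 + t = k. *)
Lemma Rpower_le_exp (k : R) :
  0 < k -> exists C, 0 < C /\ forall t, 0 < t -> Rpower (1 + t) k * exp (- t) <= C.
Proof.
  intros Hk. exists (exp (1 - k + k * ln k)). split; [apply exp_pos|].
  intros t Ht. unfold Rpower. rewrite <- exp_plus.
  assert (H : ln ((1 + t) / k) <= (1 + t) / k - 1).
  { assert (0 < (1 + t) / k) by (apply Rdiv_lt_0_compat; lra).
    pose proof (exp_ineq1_le (ln ((1 + t) / k))) as E. rewrite exp_ln in E; lra. }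
  rewrite ln_div in H by lra.
  assert (Hm : k * (ln (1 + t) - ln k) <= k * ((1 + t) / k - 1))
    by (apply Rmult_le_compat_l; lra).
  replace (k * ((1 + t) / k - 1)) with (1 + t - k) in Hm by (field; lra).
  destruct (Req_dec (k * ln (1 + t) + - t) (1 - k + k * ln k)) as [->|Hne]; [lra|].
  left. apply exp_increasing. lra.
Qed.

(** The integrand is dominated on the whole half-line by a multiple of the
    derivative of (t/(1+t))^x, a bounded function; this treats the
    singularity at 0 and the tail at once. *)
Lemma is_improper_Gamma (x : R) :
  0 < x -> is_improper (gamma_integrand x) (Gamma x).
Proof.
  intros Hx. apply (RInt_gen_correct (V:=R_CompleteNormedModule)).
  destruct (Rpower_le_exp (x + 1)) as (C & HC & Hexp); [lra|].
  apply ex_improper_of_bounded with (M := C / x).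
  - intros. apply continuous_gamma_integrand. auto.
  - intros. left. apply Rmult_lt_0_compat; apply exp_pos.
  - intros u v Huv.
    set (G := fun t => C / x * Rpower (t / (1 + t)) x).
    set (G' := fun t => C * (Rpower t (x - 1) * Rpower (1 + t) (- (x + 1)))).
    assert (HG : is_RInt G' u v (minus (G v) (G u))).
    { apply (is_RInt_derive (V:=R_CompleteNormedModule) G G').
      - intros t. rewrite Rmin_left by lra. intros Ht.
        assert (0 < t) by lra.
        assert (Hq : 0 < t / (1 + t)) by (apply Rdiv_lt_0_compat; lra).
        replace (G' t) with
          (C / x * (/ (1 + t) ^ 2 * (x * Rpower (t / (1 + t)) (x - 1)))).
        { apply (is_derive_scal (fun t => Rpower (t / (1 + t)) x)).
          apply (is_derive_comp (fun s => Rpower s x) (fun t => t / (1 + t))).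
          - apply is_derive_Rpower, Hq.
          - auto_derive; [lra|]. field. lra. }
        unfold G'. replace (t / (1 + t)) with (t * / (1 + t)) by reflexivity.
        rewrite <- Rpower_mult_distr by (try apply Rinv_0_lt_compat; lra).
        replace (Rpower (/ (1 + t)) (x - 1)) with (Rpower (1 + t) (- (x + 1)) * (1 + t) ^ 2).
        + field. lra.
        + rewrite <- Rpower_pow, <- Rpower_plus by lra.
          unfold Rpower. rewrite ln_Rinv by lra. f_equal. simpl. ring.
      - intros t. rewrite Rmin_left by lra. intros Ht.
        apply (ex_derive_continuous (V:=R_NormedModule)).
        unfold G', Rpower. auto_derive. repeat split; lra. }
    apply Rle_trans with (RInt G' u v).
    + apply RInt_le; [lra | | eexists; apply HG |].
      * apply (ex_RInt_continuous (V:=R_CompleteNormedModule)).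
        intros t. rewrite Rmin_left by lra. intros Ht.
        apply continuous_gamma_integrand. lra.
      * intros t Ht. unfold gamma_integrand, G'.
        specialize (Hexp t ltac:(lra)).
        pose proof (Rpower_pos t (x - 1)).
        replace (exp (- t)) with
          (Rpower (1 + t) (x + 1) * exp (- t) * Rpower (1 + t) (- (x + 1))).
        -- pose proof (Rpower_pos (1 + t) (- (x + 1))).
           apply Rle_trans with
             (Rpower t (x - 1) * (C * Rpower (1 + t) (- (x + 1)))); [|right; ring].
           apply Rmult_le_compat_l; [lra|]. apply Rmult_le_compat_r; lra.
        -- rewrite Rpower_Ropp. field. apply Rgt_not_eq, Rpower_pos.
    + rewrite (is_RInt_unique _ _ _ _ HG).
      unfold minus, plus, opp, G; simpl.
      assert (0 < C / x) by (apply Rdiv_lt_0_compat; lra).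
      assert (0 <= C / x * Rpower (u / (1 + u)) x)
        by (left; apply Rmult_lt_0_compat; [lra | apply Rpower_pos]).
      assert (Rpower (v / (1 + v)) x <= 1).
      { apply Rle_trans with (Rpower 1 x).
        - apply Rle_Rpower_l; [lra|]. split; [apply Rdiv_lt_0_compat; lra|].
          apply Rle_div_l; lra.
        - right. unfold Rpower. rewrite ln_1, Rmult_0_r. apply exp_0. }
      nra.
Qed.

Lemma Rpower_at_right_0 (x : R) :
  0 < x -> filterlim (fun t => Rpower t x) (at_right 0) (locally 0).
Proof.
  intros Hx. unfold Rpower.
  apply (filterlim_comp _ _ _ (fun t => x * ln t) exp _ (Rbar_locally m_infty)).
  - apply (filterlim_comp _ _ _ ln (fun y => x * y) _ (Rbar_locally m_infty)).
    + apply is_lim_ln_0.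
    + replace m_infty with (Rbar_mult x m_infty) at 2.
      * apply filterlim_Rbar_mult_l.
      * simpl. destruct (Rle_dec 0 x) as [H|H]; [|lra].
        destruct (Rle_lt_or_eq_dec 0 x H); [reflexivity|lra].
  - apply is_lim_exp_m.
Qed.

Lemma Rpower_exp_p_infty (x : R) :
  0 < x -> is_lim (fun t => Rpower t x * exp (- t)) p_infty 0.
Proof.
  intros Hx. destruct (Rpower_le_exp (x + 1)) as (C & HC & Hexp); [lra|].
  apply (is_lim_le_le_loc (fun _ => 0) (fun t => C * / t)).
  - exists 0. intros t Ht. split.
    + left. apply Rmult_lt_0_compat; apply exp_pos.
    + specialize (Hexp t Ht).
      apply (Rmult_le_reg_r t); [lra|].
      rewrite (Rmult_assoc C), Rinv_l, Rmult_1_r by lra.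
      eapply Rle_trans; [|apply Hexp].
      rewrite Rmult_assoc, (Rmult_comm (exp _)), <- Rmult_assoc.
      apply Rmult_le_compat_r; [left; apply exp_pos|].
      rewrite <- (Rpower_1 t) at 2 by lra. rewrite <- Rpower_plus.
      apply Rle_Rpower_l; lra.
  - apply is_lim_const.
  - replace (Finite 0) with (Rbar_mult C 0) by (simpl; f_equal; ring).
    apply is_lim_scal_l. apply (is_lim_inv (fun t => t) p_infty p_infty); [apply is_lim_id|discriminate].
Qed.

(** The integral of the derivative of t^x exp(-t), which vanishes at both ends. *)
Lemma Gamma_succ (x : R) : 0 < x -> Gamma (x + 1) = x * Gamma x.
Proof.
  intros Hx.
  set (G := fun t => Rpower t x * exp (- t)).
  assert (HD : forall t, 0 < t ->
    is_derive G t (x * gamma_integrand x t - gamma_integrand (x + 1) t)).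
  { intros t Ht. unfold gamma_integrand, G.
    replace (x + 1 - 1) with x by ring.
    evar_last.
    - apply (is_derive_mult (fun t => Rpower t x) (fun t => exp (- t))).
      + apply is_derive_Rpower, Ht.
      + auto_derive; [auto | reflexivity].
      + intros; apply Rmult_comm.
    - unfold plus, mult; simpl. ring. }
  assert (H1 : is_improper (Derive G) (0 - 0)).
  { apply is_RInt_gen_Derive; try typeclasses eauto.
    - apply improper_domain. intros u v Huv t Ht. simpl in Ht.
      rewrite Rmin_left in Ht by lra. eexists. apply HD. lra.
    - apply improper_domain. intros u v Huv t Ht. simpl in Ht.
      rewrite Rmin_left in Ht by lra.
      apply (continuous_ext_loc _ (fun t => x * gamma_integrand x t - gamma_integrand (x + 1) t)).
      + exists (mkposreal t ltac:(lra)). intros s Hs.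
        unfold ball in Hs; simpl in Hs;
          unfold AbsRing_ball, abs, minus, plus, opp in Hs; simpl in Hs.
        apply Rabs_lt_between in Hs. symmetry. apply is_derive_unique, HD. lra.
      + apply (continuous_minus (V:=R_NormedModule)).
        * apply (continuous_scal_r (V:=R_NormedModule) x).
          apply continuous_gamma_integrand. lra.
        * apply continuous_gamma_integrand. lra.
    - assert (E : filterlim G (at_right 0) (locally (0 * exp (- 0)))).
      { apply (filterlim_comp_2 (G := locally 0) (H := locally (exp (- 0)))
          (fun t => Rpower t x) (fun t => exp (- t)) Rmult).
        - apply Rpower_at_right_0, Hx.
        - apply (filterlim_filter_le_1 (F := locally 0)).
          + intros P HP. unfold at_right, within. revert HP. apply filter_imp. auto.
          + apply (ex_derive_continuous (V:=R_NormedModule) (fun t => exp (- t))).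
            auto_derive. auto.
        - apply (filterlim_mult (K:=R_AbsRing)). }
      rewrite Rmult_0_l in E. exact E.
    - apply (Rpower_exp_p_infty x Hx). }
  assert (H2 : is_improper (fun t => x * gamma_integrand x t - gamma_integrand (x + 1) t)
                 (0 - 0)).
  { refine (is_RInt_gen_ext _ _ _ _ H1).
    apply improper_domain. intros u v Huv t Ht. simpl in Ht.
    rewrite Rmin_left in Ht by lra. apply is_derive_unique, HD. lra. }
  assert (H3 : is_improper (fun t => x * gamma_integrand x t - gamma_integrand (x + 1) t)
                 (x * Gamma x - Gamma (x + 1))).
  { exact (is_RInt_gen_minus _ _ _ _
      (is_RInt_gen_scal _ x _ (is_improper_Gamma x Hx))
      (is_improper_Gamma (x + 1) ltac:(lra))). }
  apply (is_RInt_gen_unique (V:=R_CompleteNormedModule)) in H2.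
  apply (is_RInt_gen_unique (V:=R_CompleteNormedModule)) in H3.
  rewrite H2 in H3. lra.
Qed.

Lemma Gamma_1 : Gamma 1 = 1.
Proof.
  assert (H1 : is_improper (Derive (fun t => - exp (- t))) (0 - (-1))).
  { apply is_RInt_gen_Derive; try typeclasses eauto.
    - apply improper_domain. intros u v Huv t Ht. auto_derive. auto.
    - apply improper_domain. intros u v Huv t Ht.
      apply (continuous_ext (fun t => exp (- t))).
      + intros s. symmetry. apply is_derive_unique. auto_derive; [auto|ring].
      + apply (ex_derive_continuous (V:=R_NormedModule)). auto_derive. auto.
    - apply (filterlim_filter_le_1 (F := locally 0)).
      + intros P HP. unfold at_right, within. revert HP. apply filter_imp. auto.
      + replace (-1) with (- exp (- 0)) by (rewrite Ropp_0, exp_0; ring).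
        apply (ex_derive_continuous (V:=R_NormedModule) (fun t => - exp (- t))).
        auto_derive. auto.
    - change (is_lim (fun t => - exp (- t)) p_infty 0).
      replace (Finite 0) with (Rbar_opp 0) by (simpl; f_equal; ring).
      apply is_lim_opp.
      apply (is_lim_comp exp (fun t => - t) p_infty 0 m_infty).
      + apply is_lim_exp_m.
      + apply (is_lim_opp (fun t => t) p_infty p_infty), is_lim_id.
      + exists 0. discriminate. }
  replace (0 - -1) with 1 in H1 by ring.
  unfold Gamma. apply (is_RInt_gen_unique (V:=R_CompleteNormedModule)).
  refine (is_RInt_gen_ext _ _ _ _ H1).
  apply improper_domain. intros u v Huv t Ht. simpl in Ht.
  rewrite Rmin_left in Ht by lra. replace (1 - 1) with 0 by ring.
  rewrite Rpower_O by lra. apply is_derive_unique. auto_derive; [auto|ring].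
Qed.

(** Weighted arithmetic-geometric mean inequality: with w = s^x, the tangent line
    bound for exp is applied to 1/w and s/w, and the two
    logarithmic terms cancel. *)
Lemma Rpower_le_chord (s x : R) :
  0 < s -> 0 <= x <= 1 -> Rpower s x <= (1 - x) + x * s.
Proof.
  intros Hs Hx. unfold Rpower. set (L := ln s). set (w := exp (x * L)).
  assert (Hw : 0 < w) by apply exp_pos.
  assert (E1 : w * (1 + - (x * L)) <= 1).
  { replace 1 with (w * exp (- (x * L))) at 2
      by (unfold w; rewrite <- exp_plus, Rplus_opp_r; apply exp_0).
    apply Rmult_le_compat_l; [lra|apply exp_ineq1_le]. }
  assert (E2 : w * (1 + (1 - x) * L) <= s).
  { replace s with (w * exp ((1 - x) * L)).
    - apply Rmult_le_compat_l; [lra|apply exp_ineq1_le].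
    - unfold w. rewrite <- exp_plus. rewrite <- (exp_ln s Hs). f_equal. unfold L. ring. }
  apply Rle_trans with ((1 - x) * (w * (1 + - (x * L))) + x * (w * (1 + (1 - x) * L))).
  - right. ring.
  - apply Rplus_le_compat.
    + rewrite <- (Rmult_1_r (1 - x)) at 2. apply Rmult_le_compat_l; lra.
    + apply Rmult_le_compat_l; lra.
Qed.

(** Half of the log-convexity of Gamma: t^x is bounded by its
    tangent at t = m, which makes the integrand of Gamma (m + x) at most a
    combination of those of Gamma m and Gamma (m + 1) = m * Gamma m.  Used
    with 1 - x in place of x it also yields the matching lower bound. *)
Lemma Gamma_add_le (m x : R) :
  0 < m -> 0 <= x <= 1 -> Gamma (m + x) <= Rpower m x * Gamma m.
Proof.
  intros Hm Hx.
  assert (Hm1 : 0 < m + 1) by lra. assert (Hmx : 0 < m + x) by lra.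
  assert (H : is_improper
    (fun t => Rpower m x * (1 - x) * gamma_integrand m t +
              Rpower m x * (x / m) * gamma_integrand (m + 1) t)
    (Rpower m x * (1 - x) * Gamma m + Rpower m x * (x / m) * Gamma (m + 1))).
  { exact (is_RInt_gen_plus _ _ _ _
      (is_RInt_gen_scal _ (Rpower m x * (1 - x)) _ (is_improper_Gamma m Hm))
      (is_RInt_gen_scal _ (Rpower m x * (x / m)) _ (is_improper_Gamma (m + 1) Hm1))). }
  eapply Rle_trans; [apply Rle_abs|].
  eapply Rle_trans.
  - refine (RInt_gen_norm (V:=R_CompleteNormedModule)
      _ _ _ _ (improper_domain _ _) (improper_domain _ _) (is_improper_Gamma (m + x) Hmx) H).
    + intros u v Huv. simpl. lra.
    + intros u v Huv t Ht. simpl in Ht. assert (Ht0 : 0 < t) by lra.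
      unfold norm; simpl. unfold abs; simpl.
      rewrite Rabs_pos_eq by (left; apply Rmult_lt_0_compat; apply exp_pos).
      unfold gamma_integrand.
      replace (m + 1 - 1) with (m - 1 + 1) by ring.
      replace (m + x - 1) with (m - 1 + x) by ring.
      rewrite !Rpower_plus, Rpower_1 by lra.
      assert (Hq : 0 < t / m) by (apply Rdiv_lt_0_compat; lra).
      assert (Hch := Rpower_le_chord (t / m) x Hq Hx).
      replace (Rpower t x) with (Rpower m x * Rpower (t / m) x)
        by (rewrite Rpower_mult_distr by lra; f_equal; field; lra).
      pose proof (Rpower_pos m x). pose proof (Rpower_pos t (m - 1)).
      pose proof (exp_pos (- t)).
      assert (Hp : 0 <= Rpower m x * Rpower t (m - 1) * exp (- t))
        by (left; repeat apply Rmult_lt_0_compat; auto).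
      apply Rle_trans with (Rpower m x * Rpower t (m - 1) * exp (- t) * Rpower (t / m) x).
      + right. ring.
      + eapply Rle_trans; [apply Rmult_le_compat_l; [exact Hp | exact Hch]|].
        right. field. lra.
  - rewrite Gamma_succ by lra. right. field. lra.
Qed.

(** On (0,1] from 1 = Gamma (x + (1 - x)) <= x^(1-x) * Gamma x; beyond, by the
    functional equation. *)
Lemma Gamma_pos (x : R) : 0 < x -> 0 < Gamma x.
Proof.
  assert (H : forall n y, 0 < y -> y <= INR n + 1 -> 0 < Gamma y).
  { induction n as [|n IH]; intros y Hy Hn.
    - simpl in Hn.
      assert (E := Gamma_add_le y (1 - y) Hy ltac:(lra)).
      replace (y + (1 - y)) with 1 in E by ring. rewrite Gamma_1 in E.
      pose proof (Rpower_pos y (1 - y)).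
      apply (Rmult_lt_reg_l (Rpower y (1 - y))); lra.
    - rewrite S_INR in Hn. destruct (Rle_dec y 1) as [H1|H1].
      + apply IH; [lra|]. pose proof (pos_INR n). lra.
      + replace y with (y - 1 + 1) by ring. rewrite Gamma_succ by lra.
        apply Rmult_lt_0_compat; [lra|]. apply IH; lra. }
  intros Hx. destruct (nfloor_ex x) as [n Hn]; [lra|].
  apply (H n); lra.
Qed.

Lemma Gamma_add_INR (x : R) (n : nat) :
  0 < x -> Gamma (x + INR n) = pochhammer x n * Gamma x.
Proof.
  intros Hx. induction n as [|n IH].
  - simpl. rewrite Rplus_0_r. ring.
  - rewrite S_INR, <- Rplus_assoc, Gamma_succ, IH.
    + simpl. ring.
    + pose proof (pos_INR n). lra.
Qed.

Lemma pochhammer_1 (n : nat) : pochhammer 1 n = INR (fact n).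
Proof.
  induction n as [|n IH]; [reflexivity|].
  simpl pochhammer. rewrite IH, fact_simpl, mult_INR, S_INR. ring.
Qed.

(** The reciprocal of Gauss's approximation n! n^(x-1) / (x,n) of the Gamma
    function; the exponent of n makes quotients of these expressions reproduce
    the hypergeometric coefficients up to a factor n. *)
Definition gauss (x : R) (n : nat) : R :=
  pochhammer x n / (INR (fact n) * Rpower (INR n) (x - 1)).

Lemma gauss_add_1 (x : R) (n : nat) :
  0 < x -> (0 < n)%nat -> gauss (x + 1) n = gauss x n * (1 + x * / INR n) / x.
Proof.
  intros Hx Hn. unfold gauss.
  assert (Hn' : 0 < INR n) by (apply lt_0_INR, Hn).
  assert (E : x * pochhammer (x + 1) n = pochhammer x n * (x + INR n)).
  { clear Hn Hn'. induction n as [|n IH].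
    - simpl. ring.
    - simpl pochhammer. rewrite S_INR, <- Rmult_assoc, IH. ring. }
  replace (x + 1 - 1) with (x - 1 + 1) by ring.
  rewrite Rpower_plus, Rpower_1 by exact Hn'.
  replace (pochhammer (x + 1) n) with (pochhammer x n * (x + INR n) / x)
    by (rewrite <- E; field; lra).
  field. repeat split; try lra.
  - apply Rgt_not_eq, Rpower_pos.
  - apply INR_fact_neq_0.
Qed.

(** For 0 < x <= 1 the bound [Gamma_add_le], taken from n to n + x and from
    n + x to n + 1, squeezes gauss x n * Gamma x between 1 / (1 + x/n) and 1.
    The functional equation propagates the limit to larger x. *)
Lemma is_lim_seq_gauss : forall x, 0 < x -> is_lim_seq (gauss x) (/ Gamma x).
Proof.
  assert (H : forall n y, 0 < y -> y <= INR n + 1 -> is_lim_seq (gauss y) (/ Gamma y)).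
  { induction n as [|k IH]; intros x Hx Hk.
    - simpl in Hk.
      assert (HG := Gamma_pos x Hx).
      apply (is_lim_seq_le_le_loc (fun n => / (1 + x * / INR n) * / Gamma x) _ (fun n => / Gamma x)).
      + exists 1%nat. intros n Hn.
        assert (Hn' : 0 < INR n) by (apply lt_0_INR; lia).
        assert (Hfact : Gamma (INR n) = INR (fact n) / INR n).
        { assert (E := Gamma_add_INR 1 n ltac:(lra)).
          rewrite Gamma_1, pochhammer_1, Rplus_comm, Gamma_succ in E by exact Hn'.
          rewrite <- (Rmult_1_r (INR (fact n))), <- E. field. lra. }
        assert (U := Gamma_add_le (INR n) x Hn' ltac:(lra)).
        assert (L := Gamma_add_le (INR n + x) (1 - x) ltac:(lra) ltac:(lra)).
        replace (INR n + x + (1 - x)) with (INR n + 1) in L by ring.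
        rewrite Gamma_succ in L by exact Hn'.
        rewrite (Rplus_comm (INR n) x), Gamma_add_INR, Hfact in * by exact Hx.
        assert (Hf := INR_fact_lt_0 n).
        assert (Hw := Rpower_pos (INR n) x).
        assert (Eg : gauss x n = pochhammer x n * Gamma x * (INR n / (INR (fact n) * Rpower (INR n) x)) * / Gamma x).
        { unfold gauss. unfold Rminus. rewrite Rpower_plus, Rpower_Ropp, Rpower_1 by exact Hn'.
          field. repeat split; lra. }
        assert (Hc : 0 < INR n / (INR (fact n) * Rpower (INR n) x)).
        { apply Rdiv_lt_0_compat; [lra|]. apply Rmult_lt_0_compat; lra. }
        assert (HGi : 0 < / Gamma x) by (apply Rinv_0_lt_compat; lra).
        rewrite Eg. split.
        * apply Rmult_le_compat_r; [lra|].
          assert (B : Rpower (x + INR n) (1 - x) <= (1 + x * / INR n) * Rpower (INR n) (1 - x)).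
          { replace (x + INR n) with ((1 + x * / INR n) * INR n) by (field; lra).
            assert (0 < x * / INR n) by (apply Rmult_lt_0_compat; [lra|apply Rinv_0_lt_compat; lra]).
            rewrite <- Rpower_mult_distr by lra.
            apply Rmult_le_compat_r; [left; apply Rpower_pos|].
            rewrite <- (Rpower_1 (1 + x * / INR n)) at 2 by lra.
            apply Rle_Rpower; lra. }
          assert (E1 : Rpower (INR n) (1 - x) = INR n / Rpower (INR n) x).
          { unfold Rminus, Rdiv. rewrite Rpower_plus, Rpower_Ropp, Rpower_1 by exact Hn'. reflexivity. }
          rewrite E1 in B.
          set (g := pochhammer x n * Gamma x) in *.
          assert (Hg : 0 < g) by (apply Rmult_lt_0_compat; [apply pochhammer_pos; lra|lra]).
          assert (Hq : 0 < 1 + x * / INR n).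
          { assert (0 < x * / INR n) by (apply Rmult_lt_0_compat; [lra|apply Rinv_0_lt_compat; lra]). lra. }
          replace (INR n * (INR (fact n) / INR n)) with (INR (fact n)) in L by (field; lra).
          assert (L2 : INR (fact n) <= (1 + x * / INR n) * (INR n / Rpower (INR n) x) * g).
          { eapply Rle_trans; [exact L|]. apply Rmult_le_compat_r; lra. }
          apply (Rmult_le_reg_l (1 + x * / INR n)); [exact Hq|].
          rewrite Rinv_r by lra.
          apply (Rmult_le_reg_l (INR (fact n))); [exact Hf|].
          rewrite Rmult_1_r. eapply Rle_trans; [exact L2|]. right. field. repeat split; lra.
        * rewrite <- (Rmult_1_l (/ Gamma x)) at 2. apply Rmult_le_compat_r; [lra|].
          eapply Rle_trans; [apply Rmult_le_compat_r; [left; exact Hc|exact U]|].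
          right. field. repeat split; lra.
      + replace (Finite (/ Gamma x)) with (Rbar_mult (/ (1 + x * 0)) (/ Gamma x))
          by (simpl; f_equal; field; lra).
        apply (is_lim_seq_scal_r (fun n => / (1 + x * / INR n)) (/ Gamma x) (/ (1 + x * 0))).
        apply (is_lim_seq_inv (fun n => 1 + x * / INR n) (1 + x * 0)).
        * apply (is_lim_seq_plus' (fun _ => 1)); [apply is_lim_seq_const|].
          apply (is_lim_seq_scal_l (fun n => / INR n) x 0), is_lim_seq_inv_INR.
        * intros E. inversion E. lra.
      + apply is_lim_seq_const.
    - rewrite S_INR in Hk. destruct (Rle_dec x 1) as [H1|H1].
      + apply IH; [lra|]. pose proof (pos_INR k). lra.
      + set (y := x - 1). replace x with (y + 1) by (unfold y; ring).
        assert (Hy : 0 < y) by (unfold y; lra).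
        rewrite Gamma_succ by exact Hy.
        apply (is_lim_seq_ext_loc (fun n => gauss y n * ((1 + y * / INR n) * / y))).
        { exists 1%nat. intros n Hn. rewrite gauss_add_1 by (lia || lra).
          unfold Rdiv. ring. }
        assert (HG := Gamma_pos y Hy).
        replace (/ (y * Gamma y)) with (/ Gamma y * ((1 + y * 0) * / y)) by (field; lra).
        apply is_lim_seq_mult'.
        * apply IH; unfold y; lra.
        * apply is_lim_seq_mult'; [|apply is_lim_seq_const].
          apply (is_lim_seq_plus' (fun _ => 1)); [apply is_lim_seq_const|].
          apply (is_lim_seq_scal_l (fun n => / INR n) y 0), is_lim_seq_inv_INR. }
  intros x Hx. destruct (nfloor_ex x) as [n Hn]; [lra|]. apply (H n); lra.
Qed.

(** * Wallis's formula *)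

Definition wallis (n : nat) : R := RInt (fun t => sin t ^ n) 0 (PI / 2).

Lemma continuous_sin_pow (n : nat) (t : R) : continuous (fun t => sin t ^ n) t.
Proof.
  apply (ex_derive_continuous (V:=R_NormedModule)). auto_derive. auto.
Qed.

Lemma ex_RInt_sin_pow (n : nat) : ex_RInt (fun t => sin t ^ n) 0 (PI / 2).
Proof.
  apply (ex_RInt_continuous (V:=R_CompleteNormedModule)). intros. apply continuous_sin_pow.
Qed.

Lemma wallis_0 : wallis 0 = PI / 2.
Proof.
  unfold wallis. simpl. rewrite RInt_const. unfold scal; simpl; unfold mult; simpl. ring.
Qed.

Lemma wallis_1 : wallis 1 = 1.
Proof.
  apply is_RInt_unique.
  replace 1 with (minus (- cos (PI / 2)) (- cos 0)).
  - apply (is_RInt_derive (fun t => - cos t) (fun t => sin t ^ 1)).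
    + intros t _. auto_derive; [auto|ring].
    + intros. apply continuous_sin_pow.
  - rewrite cos_PI2, cos_0. unfold minus, plus, opp; simpl. ring.
Qed.

(** Integration of the derivative of - cos t * sin t ^ (n + 1), which
    vanishes at both ends. *)
Lemma wallis_step (n : nat) :
  wallis (S (S n)) = (INR n + 1) / (INR n + 2) * wallis n.
Proof.
  assert (H : is_RInt (fun t => (INR n + 2) * sin t ^ (S (S n)) - (INR n + 1) * sin t ^ n)
                0 (PI / 2) 0).
  { replace 0 with (minus (- cos (PI / 2) * sin (PI / 2) ^ (S n)) (- cos 0 * sin 0 ^ (S n))) at 2.
    - apply (is_RInt_derive (fun t => - cos t * sin t ^ (S n))).
      + intros t _.
        auto_derive; [auto|]. change (Init.Nat.pred (S n)) with n.
        change (INR (S n)) with (match n with 0%nat => 1 | S _ => INR n + 1 end).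
        replace (match n with 0%nat => 1 | S _ => INR n + 1 end) with (INR n + 1)
          by (destruct n; simpl; ring).
        assert (E : cos t * cos t = 1 - sin t * sin t)
          by (pose proof (sin2_cos2 t) as E; unfold Rsqr in E; lra).
        simpl.
        transitivity (sin t * (sin t * sin t ^ n) - (INR n + 1) * (cos t * cos t) * sin t ^ n);
          [ring | rewrite E; ring].
      + intros t _. apply (continuous_minus (V:=R_NormedModule));
          apply (continuous_scal_r (V:=R_NormedModule)); apply continuous_sin_pow.
    - rewrite cos_PI2, sin_0, pow_i by lia. unfold minus, plus, opp; simpl. ring. }
  assert (H' : is_RInt (fun t => (INR n + 2) * sin t ^ (S (S n)) - (INR n + 1) * sin t ^ n)
                 0 (PI / 2) ((INR n + 2) * wallis (S (S n)) - (INR n + 1) * wallis n)).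
  { exact (is_RInt_minus _ _ _ _ _ _
     (is_RInt_scal _ _ _ (INR n + 2) _ (RInt_correct _ _ _ (ex_RInt_sin_pow (S (S n)))))
     (is_RInt_scal _ _ _ (INR n + 1) _ (RInt_correct _ _ _ (ex_RInt_sin_pow n)))). }
  apply (is_RInt_unique (V:=R_CompleteNormedModule)) in H.
  apply (is_RInt_unique (V:=R_CompleteNormedModule)) in H'.
  rewrite H in H'.
  pose proof (pos_INR n).
  apply (Rmult_eq_reg_l (INR n + 2)); [|lra].
  replace ((INR n + 2) * ((INR n + 1) / (INR n + 2) * wallis n))
    with ((INR n + 1) * wallis n) by (field; lra). lra.
Qed.

Lemma wallis_decr (n : nat) : wallis (S n) <= wallis n.
Proof.
  pose proof PI_RGT_0.
  apply RInt_le; [lra | apply ex_RInt_sin_pow | apply ex_RInt_sin_pow |].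
  intros t Ht. assert (0 < sin t) by (apply sin_gt_0; lra).
  pose proof (SIN_bound t). simpl.
  assert (0 < sin t ^ n) by (apply pow_lt; lra). nra.
Qed.

Lemma wallis_prod (n : nat) : (INR n + 1) * (wallis n * wallis (S n)) = PI / 2.
Proof.
  induction n as [|n IH].
  - rewrite wallis_0, wallis_1. simpl. ring.
  - rewrite wallis_step, S_INR, <- IH. pose proof (pos_INR n). field. lra.
Qed.

Lemma wallis_even (n : nat) :
  wallis (2 * n) = PI / 2 * (pochhammer (1 / 2) n / INR (fact n)).
Proof.
  induction n as [|n IH].
  - simpl (2 * 0)%nat. rewrite wallis_0. simpl. field.
  - replace (2 * S n)%nat with (S (S (2 * n))) by lia.
    rewrite wallis_step, IH, fact_simpl, !mult_INR, (S_INR n). simpl pochhammer.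
    change (INR 2) with 2.
    pose proof (pos_INR n). pose proof (INR_fact_lt_0 n). field. lra.
Qed.

Lemma wallis_pos (n : nat) : 0 < wallis n.
Proof.
  assert (H : 0 < wallis n /\ 0 < wallis (S n)); [|tauto].
  induction n as [|n IH].
  - rewrite wallis_0, wallis_1. pose proof PI_RGT_0. lra.
  - split; [tauto|]. rewrite wallis_step. pose proof (pos_INR n).
    apply Rmult_lt_0_compat; [apply Rdiv_lt_0_compat; lra|tauto].
Qed.

(** Since the integrals decrease, the square of the one of index 2n lies between
    its products with its two neighbours, and those products are known
    exactly. *)
Lemma wallis_limit :
  is_lim_seq (fun n => INR n * (pochhammer (1 / 2) n / INR (fact n)) ^ 2) (/ PI).
Proof.
  pose proof PI_RGT_0 as HPI.
  apply (is_lim_seq_le_le_loc (fun n => / PI * / (1 + / 2 * / INR n)) _ (fun _ => / PI)).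
  - exists 1%nat. intros n Hn. assert (Hn' : 0 < INR n) by (apply lt_0_INR; lia).
    set (w := pochhammer (1 / 2) n / INR (fact n)).
    assert (Hw : wallis (2 * n) = PI / 2 * w) by apply wallis_even.
    assert (E2 : INR (2 * n) = 2 * INR n) by (rewrite mult_INR; reflexivity).
    pose proof (wallis_pos (2 * n)) as Hp.
    split.
    + assert (P := wallis_prod (2 * n)). rewrite E2 in P.
      pose proof (wallis_decr (2 * n)).
      assert (PI / 2 <= (2 * INR n + 1) * (wallis (2 * n) * wallis (2 * n))).
      { rewrite <- P. apply Rmult_le_compat_l; [lra|]. apply Rmult_le_compat_l; lra. }
      rewrite Hw in H0.
      replace (/ PI * / (1 + / 2 * / INR n)) with (2 * INR n / (PI * (2 * INR n + 1)))
        by (field; lra).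
      apply Rle_div_l; [apply Rmult_lt_0_compat; lra|].
      apply (Rmult_le_reg_l (PI / 4)); [lra|].
      apply (Rmult_le_compat_l (INR n)) in H0; [|lra].
      replace (PI / 4 * (2 * INR n)) with (INR n * (PI / 2)) by field.
      eapply Rle_trans; [exact H0|]. right. field.
    + set (m := (2 * n - 1)%nat). assert (Em : (2 * n)%nat = S m) by (unfold m; lia).
      assert (P := wallis_prod m).
      replace (INR m + 1) with (2 * INR n) in P by (rewrite <- E2, Em, S_INR; reflexivity).
      pose proof (wallis_decr m). rewrite <- Em in *.
      assert (2 * INR n * (wallis (2 * n) * wallis (2 * n)) <= PI / 2).
      { rewrite <- P. apply Rmult_le_compat_l; [lra|].
        apply Rmult_le_compat_r; [left; apply wallis_pos|lra]. }
      rewrite Hw in H0.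
      apply (Rmult_le_reg_l (PI * PI / 2)); [nra|].
      replace (PI * PI / 2 * / PI) with (PI / 2) by (field; lra).
      eapply Rle_trans; [|exact H0]. right. field.
  - replace (Finite (/ PI)) with (Finite (/ PI * / (1 + / 2 * 0))) by (f_equal; field; lra).
    apply is_lim_seq_mult'; [apply is_lim_seq_const|].
    apply (is_lim_seq_inv (fun n => 1 + / 2 * / INR n) (1 + / 2 * 0)).
    + apply (is_lim_seq_plus' (fun _ => 1)); [apply is_lim_seq_const|].
      apply (is_lim_seq_scal_l (fun n => / INR n) (/ 2) 0).
      apply is_lim_seq_inv_INR.
    + intros E. inversion E. lra.
  - apply is_lim_seq_const.
Qed.

(** * Landen's transformation *)

(** The coefficients of F(1/2,1/2;1;x), that is, of 2/pi times the complete
    elliptic integral of the first kind as a function of the squared modulus. *)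
Definition legendre_coef (n : nat) : R := (pochhammer (1 / 2) n / INR (fact n)) ^ 2.

Lemma legendre_coef_succ (n : nat) :
  legendre_coef (S n) = legendre_coef n * ((INR n + 1 / 2) / (INR n + 1)) ^ 2.
Proof.
  unfold legendre_coef. rewrite fact_simpl, mult_INR, S_INR. simpl pochhammer.
  assert (H := INR_fact_neq_0 n). pose proof (pos_INR n).
  field. repeat split; first [exact H | lra].
Qed.

Lemma legendre_coef_bounds (n : nat) : 0 < legendre_coef n <= 1.
Proof.
  induction n as [|n IH].
  - unfold legendre_coef. simpl. lra.
  - rewrite legendre_coef_succ. pose proof (pos_INR n).
    assert (0 < (INR n + 1 / 2) / (INR n + 1) <= 1).
    { split; [apply Rdiv_lt_0_compat; lra|]. apply Rle_div_l; lra. }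
    set (q := (INR n + 1 / 2) / (INR n + 1)) in *.
    assert (0 < q ^ 2 <= 1) by (split; nra). split; nra.
Qed.

Definition legendre_P : R -> R := PSeries legendre_coef.
Definition legendre_Q : R -> R := PSeries (PS_derive legendre_coef).
(** This series is x(1-x)P'(x) ([legendre_S_eq]).  Given by its own coefficients,
    it makes the hypergeometric equation of P the first-order relation
    S' = P/4, with no second derivative of P. *)
Definition legendre_S : R -> R :=
  PSeries (PS_incr_1 (fun n => legendre_coef n / (4 * (INR n + 1)))).

Lemma CV_legendre (x : R) : -1 < x < 1 -> Rbar_lt (Rabs x) (CV_radius legendre_coef).
Proof.
  intros Hx. apply CV_radius_ge_1 with 1; [|exact Hx].
  intros n. pose proof (legendre_coef_bounds n). rewrite Rabs_pos_eq; lra.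
Qed.

Lemma is_derive_P (x : R) : -1 < x < 1 -> is_derive legendre_P x (legendre_Q x).
Proof. intros Hx. apply is_derive_PSeries, CV_legendre, Hx. Qed.

Lemma is_derive_S (x : R) : -1 < x < 1 -> is_derive legendre_S x (/ 4 * legendre_P x).
Proof.
  intros Hx. unfold legendre_P. rewrite <- PSeries_scal.
  rewrite <- (PSeries_ext (PS_derive (PS_incr_1 (fun n => legendre_coef n / (4 * (INR n + 1)))))).
  - apply is_derive_PSeries. rewrite CV_radius_incr_1.
    apply CV_radius_ge_1 with 1; [|exact Hx].
    intros n. pose proof (legendre_coef_bounds n). pose proof (pos_INR n).
    rewrite Rabs_pos_eq.
    + apply Rle_div_l; lra.
    + left; apply Rdiv_lt_0_compat; lra.
  - intros n. unfold PS_derive, PS_incr_1, PS_scal, scal; simpl PS_incr_1.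
    simpl; unfold mult; simpl. pose proof (pos_INR n).
    replace (match n with 0%nat => 1 | S _ => INR n + 1 end) with (INR n + 1)
      by (destruct n; simpl; ring).
    field. lra.
Qed.

(** Coefficientwise, this is the recurrence
    (n+1)^2 c(n+1) = (n+1/2)^2 c(n). *)
Lemma legendre_S_eq (x : R) :
  -1 < x < 1 -> legendre_S x = x * (1 - x) * legendre_Q x.
Proof.
  intros Hx.
  assert (HQ : ex_pseries (PS_derive legendre_coef) x)
    by (apply ex_pseries_derive, CV_legendre, Hx).
  set (u := PS_incr_1 (PS_derive legendre_coef)).
  assert (Hu : ex_pseries u x) by (apply ex_pseries_incr_1; exact HQ).
  transitivity (PSeries (PS_minus u (PS_incr_1 u)) x).
  - apply PSeries_ext. intros n.
    unfold u, PS_minus, PS_plus, PS_opp, PS_incr_1, PS_derive, plus, opp, zero; simpl.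
    destruct n as [|n]; [simpl; ring|].
    destruct n as [|n].
    + rewrite legendre_coef_succ. simpl. field.
    + rewrite (legendre_coef_succ (S n)), !S_INR. pose proof (pos_INR n).
      replace (match n with 0%nat => 1 | S _ => INR n + 1 end) with (INR n + 1)
        by (destruct n; simpl; ring).
      field. lra.
  - rewrite PSeries_minus.
    + unfold u. rewrite !PSeries_incr_1. unfold legendre_Q. ring.
    + exact Hu.
    + apply ex_pseries_incr_1; exact Hu.
Qed.

Lemma legendre_P_ge_1 (x : R) : 0 <= x < 1 -> 1 <= legendre_P x.
Proof.
  intros Hx.
  apply Rle_trans with (legendre_coef 0 * x ^ 0); [unfold legendre_coef; simpl; lra|].
  apply (term_le_Series (fun n => legendre_coef n * x ^ n) 0).
  - intros n. apply Rmult_le_pos; [left; apply legendre_coef_bounds | apply pow_le; lra].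
  - apply ex_pseries_R, CV_radius_inside, CV_legendre. lra.
Qed.

Definition landen (r : R) : R := 4 * r / (1 + r) ^ 2.

Lemma landen_bounds (r : R) : 0 <= r < 1 -> 0 <= landen r < 1.
Proof.
  intros Hr. unfold landen. split.
  - apply Rle_div_r; nra.
  - apply Rlt_div_l; nra.
Qed.

Lemma is_derive_landen (r : R) :
  0 <= r < 1 -> is_derive landen r (4 * (1 - r) / (1 + r) ^ 3).
Proof. intros Hr. unfold landen. auto_derive; [nra|]. field. lra. Qed.

(** The two sides of Landen's identity, divided by 1 + r. *)
Definition left_sol (r : R) : R := legendre_P (r ^ 2).
Definition right_sol (r : R) : R := legendre_P (landen r) / (1 + r).

Lemma sqr_bounds (r : R) : 0 <= r < 1 -> 0 <= r ^ 2 < 1.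
Proof. intros; split; nra. Qed.

Lemma is_derive_left (r : R) :
  0 <= r < 1 -> is_derive left_sol r (2 * r * legendre_Q (r ^ 2)).
Proof.
  intros Hr. pose proof (sqr_bounds r Hr).
  apply (is_derive_comp legendre_P (fun r => r ^ 2)).
  - apply is_derive_P; lra.
  - auto_derive; [auto|ring].
Qed.

Lemma is_derive_right (r : R) :
  0 <= r < 1 -> is_derive right_sol r
    (4 * (1 - r) / (1 + r) ^ 4 * legendre_Q (landen r) - legendre_P (landen r) / (1 + r) ^ 2).
Proof.
  intros Hr. pose proof (landen_bounds r Hr).
  evar_last.
  - apply (is_derive_div (fun r => legendre_P (landen r)) (fun r => 1 + r)).
    + apply (is_derive_comp legendre_P landen); [apply is_derive_P; lra|].
      apply is_derive_landen, Hr.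
    + auto_derive; auto.
    + lra.
  - unfold scal; simpl; unfold mult; simpl. field. lra.
Qed.

(** For y = left_sol and y = right_sol, the function r(1-r^2)y'(r)
    ([flux_left_eq], [flux_right_eq]), written so that it can be differentiated
    through S' = P/4 alone. *)
Definition flux_left (r : R) : R := 2 * legendre_S (r ^ 2).
Definition flux_right (r : R) : R :=
  (1 + r) * legendre_S (landen r) - r * (1 - r) * right_sol r.

Lemma flux_left_eq (r : R) :
  0 <= r < 1 -> flux_left r = r * (1 - r ^ 2) * (2 * r * legendre_Q (r ^ 2)).
Proof.
  intros Hr. pose proof (sqr_bounds r Hr). unfold flux_left.
  rewrite legendre_S_eq by lra. ring.
Qed.

Lemma flux_right_eq (r : R) :
  0 <= r < 1 -> flux_right r = r * (1 - r ^ 2) *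
    (4 * (1 - r) / (1 + r) ^ 4 * legendre_Q (landen r) - legendre_P (landen r) / (1 + r) ^ 2).
Proof.
  intros Hr. pose proof (landen_bounds r Hr). unfold flux_right, right_sol.
  rewrite legendre_S_eq by lra.
  set (Q := legendre_Q (landen r)). set (P := legendre_P (landen r)).
  unfold landen. field. lra.
Qed.

Lemma is_derive_flux_left (r : R) :
  0 <= r < 1 -> is_derive flux_left r (r * left_sol r).
Proof.
  intros Hr. pose proof (sqr_bounds r Hr). unfold flux_left, left_sol.
  evar_last.
  - apply (is_derive_scal (fun r => legendre_S (r ^ 2)) r 2).
    apply (is_derive_comp legendre_S (fun r => r ^ 2)).
    + apply is_derive_S; lra.
    + auto_derive; [auto|reflexivity].
  - unfold scal; simpl; unfold mult; simpl. field.
Qed.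

(** With [is_derive_flux_left], this says that both functions solve
    (r(1-r^2)y')' = ry. *)
Lemma is_derive_flux_right (r : R) :
  0 <= r < 1 -> is_derive flux_right r (r * right_sol r).
Proof.
  intros Hr. pose proof (landen_bounds r Hr). unfold flux_right.
  evar_last.
  - apply (is_derive_minus (fun r => (1 + r) * legendre_S (landen r))
                           (fun r => r * (1 - r) * right_sol r)).
    + apply (is_derive_mult (fun r => 1 + r) (fun r => legendre_S (landen r))).
      * auto_derive; [auto|reflexivity].
      * apply (is_derive_comp legendre_S landen); [apply is_derive_S; lra|].
        apply is_derive_landen, Hr.
      * intros; apply Rmult_comm.
    + apply (is_derive_mult (fun r => r * (1 - r)) right_sol).
      * auto_derive; [auto|reflexivity].
      * apply is_derive_right, Hr.
      * intros; apply Rmult_comm.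
  - unfold minus, plus, opp, mult, scal; simpl; unfold mult; simpl.
    unfold right_sol. rewrite legendre_S_eq by lra.
    set (Q := legendre_Q (landen r)). set (P := legendre_P (landen r)).
    unfold landen. field. lra.
Qed.

(** The Wronskian times r(1-r^2) is constant, and it vanishes at the singular
    point 0. *)
Lemma wronskian_0 (r : R) :
  0 <= r < 1 -> left_sol r * flux_right r - right_sol r * flux_left r = 0.
Proof.
  intros Hr.
  set (w := fun r => left_sol r * flux_right r - right_sol r * flux_left r).
  change (w r = 0).
  assert (H0 : w 0 = 0).
  { unfold w. rewrite flux_left_eq, flux_right_eq by lra. ring. }
  destruct (Req_dec r 0) as [->|Hr0]; [exact H0|].
  rewrite <- H0. symmetry. apply eq_is_derive; [|lra].
  intros t Ht. assert (Ht1 : 0 <= t < 1) by lra. evar_last.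
  - apply (is_derive_minus (fun r => left_sol r * flux_right r)
                           (fun r => right_sol r * flux_left r)).
    + apply (is_derive_mult left_sol flux_right).
      * apply is_derive_left, Ht1.
      * apply is_derive_flux_right, Ht1.
      * intros; apply Rmult_comm.
    + apply (is_derive_mult right_sol flux_left).
      * apply is_derive_right, Ht1.
      * apply is_derive_flux_left, Ht1.
      * intros; apply Rmult_comm.
  - unfold minus, plus, opp, mult, zero; simpl.
    rewrite flux_left_eq, flux_right_eq by exact Ht1.
    replace (t * (t * 1)) with (t ^ 2) by ring. field. lra.
Qed.

(** Away from 0, the vanishing Wronskian gives the quotient of the two solutions a zero
    derivative; at 0 their derivatives are computed directly.  The
    quotient is therefore its value at 0, which is 1. *)
Lemma landen_identity (r : R) :
  0 < r < 1 -> (1 + r) * legendre_P (r ^ 2) = legendre_P (landen r).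
Proof.
  intros Hr.
  assert (Hpos : forall t, 0 <= t < 1 -> left_sol t <> 0).
  { intros t Ht. pose proof (legendre_P_ge_1 (t ^ 2) (sqr_bounds t Ht)).
    unfold left_sol. lra. }
  assert (E : right_sol 0 / left_sol 0 = right_sol r / left_sol r).
  { apply (eq_is_derive (fun t => right_sol t / left_sol t)); [|lra].
    intros t Ht. assert (Ht1 : 0 <= t < 1) by lra. evar_last.
    - apply is_derive_div;
        [apply is_derive_right, Ht1 | apply is_derive_left, Ht1 | apply Hpos, Ht1].
    - unfold zero; simpl.
      match goal with |- ?N / _ = 0 => cut (N = 0) end.
      { intros ->. field. apply Hpos, Ht1. }
      destruct (Req_dec t 0) as [->|Ht0].
      + unfold left_sol, right_sol, landen.
        replace (4 * 0 / (1 + 0) ^ 2) with 0 by field. replace (0 ^ 2) with 0 by ring.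
        unfold legendre_P, legendre_Q. rewrite !PSeries_0. unfold PS_derive, legendre_coef.
        simpl. field.
      + assert (W := wronskian_0 t Ht1).
        rewrite flux_left_eq, flux_right_eq in W by exact Ht1.
        apply (Rmult_eq_reg_l (t * (1 - t ^ 2))); [|apply Rmult_integral_contrapositive; split; nra].
        rewrite Rmult_0_r, <- W.
        replace (t * (t * 1)) with (t ^ 2) by ring. field. lra. }
  assert (E0 : right_sol 0 / left_sol 0 = 1).
  { unfold left_sol, right_sol, landen.
    replace (4 * 0 / (1 + 0) ^ 2) with 0 by field. replace (0 ^ 2) with 0 by ring.
    unfold legendre_P. rewrite !PSeries_0. unfold legendre_coef. simpl. field. }
  rewrite E0 in E. pose proof (Hpos r ltac:(lra)) as Hl.
  apply (Rmult_eq_compat_r (left_sol r)) in E.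
  unfold Rdiv in E. rewrite Rmult_assoc, Rinv_l, Rmult_1_l, Rmult_1_r in E by exact Hl.
  unfold left_sol, right_sol in E. rewrite E. field. lra.
Qed.

Lemma sqr_lt_landen (r : R) : 0 < r < 1 -> 0 < r ^ 2 < landen r.
Proof.
  intros Hr. split; [apply pow_lt; lra|]. unfold landen.
  apply (Rlt_div_r (r ^ 2) (4 * r) ((1 + r) ^ 2)); [apply pow_lt; lra|].
  replace (r ^ 2 * (1 + r) ^ 2) with (r * (r * (1 + r) ^ 2)) by ring.
  rewrite (Rmult_comm 4). apply Rmult_lt_compat_l; [lra|].
  assert ((1 + r) ^ 2 < 4) by nra. nra.
Qed.

(** * The coefficients of the zero-balanced series *)

Definition zb_coef (a b : R) (n : nat) : R :=
  pochhammer a n * pochhammer b n / (pochhammer (a + b) n * INR (fact n)).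

Lemma zb_coef_pos (a b : R) (n : nat) : 0 < a -> 0 < b -> 0 < zb_coef a b n.
Proof.
  intros Ha Hb. unfold zb_coef. pose proof (INR_fact_lt_0 n).
  apply Rdiv_lt_0_compat; apply Rmult_lt_0_compat; try apply pochhammer_pos; lra.
Qed.

(** Both sequences have rational successive quotients; over a common
    denominator the cubic and quadratic terms in n of
    (a+n)(b+n)(n+1) - (a+b+n)(n+1/2)^2 cancel, and a linear factor remains. *)
Lemma zb_coef_cross (a b : R) (n : nat) :
  0 < a -> 0 < b ->
  zb_coef a b (S n) * legendre_coef n - zb_coef a b n * legendre_coef (S n) =
  zb_coef a b n * legendre_coef n / ((a + b + INR n) * (INR n + 1) ^ 2) *
  ((a * b - 1 / 4) * INR n + (a * b - (a + b) / 4)).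
Proof.
  intros Ha Hb. pose proof (pos_INR n).
  rewrite legendre_coef_succ.
  assert (E : zb_coef a b (S n) =
    zb_coef a b n * ((a + INR n) * (b + INR n) / ((a + b + INR n) * (INR n + 1)))).
  { unfold zb_coef. rewrite fact_simpl, mult_INR, S_INR. simpl pochhammer.
    pose proof (INR_fact_lt_0 n). pose proof (pochhammer_pos (a + b) n ltac:(lra)).
    field. repeat split; lra. }
  rewrite E. field. lra.
Qed.

Lemma zb_coef_weight_pos (a b : R) (n : nat) :
  0 < a -> 0 < b ->
  0 < zb_coef a b n * legendre_coef n / ((a + b + INR n) * (INR n + 1) ^ 2).
Proof.
  intros Ha Hb. pose proof (pos_INR n). pose proof (zb_coef_pos a b n Ha Hb).
  pose proof (legendre_coef_bounds n).
  apply Rdiv_lt_0_compat.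
  - apply Rmult_lt_0_compat; lra.
  - apply Rmult_lt_0_compat; [lra | apply pow_lt; lra].
Qed.

(** For n >= 1, the n-th coefficient times n is gauss a n * gauss b n / gauss (a+b) n. *)
Lemma zb_coef_limit (a b : R) :
  0 < a -> 0 < b -> is_lim_seq (fun n => INR n * zb_coef a b n) (/ Beta a b).
Proof.
  intros Ha Hb.
  pose proof (Gamma_pos a Ha). pose proof (Gamma_pos b Hb).
  pose proof (Gamma_pos (a + b) ltac:(lra)).
  apply (is_lim_seq_ext_loc (fun n => gauss a n * gauss b n / gauss (a + b) n)).
  - exists 1%nat. intros n Hn. assert (Hn' : 0 < INR n) by (apply lt_0_INR; lia).
    unfold gauss, zb_coef.
    replace (Rpower (INR n) (a + b - 1))
      with (Rpower (INR n) (a - 1) * Rpower (INR n) (b - 1) * INR n).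
    2:{ rewrite <- (Rpower_1 (INR n)) at 3 by exact Hn'.
        rewrite <- !Rpower_plus. f_equal. ring. }
    pose proof (INR_fact_lt_0 n). pose proof (pochhammer_pos (a + b) n ltac:(lra)).
    pose proof (Rpower_pos (INR n) (a - 1)). pose proof (Rpower_pos (INR n) (b - 1)).
    field. repeat split; lra.
  - replace (/ Beta a b) with (/ Gamma a * / Gamma b / / Gamma (a + b))
      by (unfold Beta; field; repeat split; lra).
    apply is_lim_seq_div'.
    + apply is_lim_seq_mult'; apply is_lim_seq_gauss; assumption.
    + apply is_lim_seq_gauss; lra.
    + apply Rinv_neq_0_compat; lra.
Qed.

Lemma Beta_pos (a b : R) : 0 < a -> 0 < b -> 0 < Beta a b.
Proof.
  intros Ha Hb. apply Rdiv_lt_0_compat; [apply Rmult_lt_0_compat|]; apply Gamma_pos; lra.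
Qed.

Lemma coef_ratio_limit (a b : R) :
  0 < a -> 0 < b ->
  is_lim_seq (fun n => zb_coef a b n / legendre_coef n) (PI / Beta a b).
Proof.
  intros Ha Hb. pose proof PI_RGT_0. pose proof (Beta_pos a b Ha Hb).
  apply (is_lim_seq_ext_loc (fun n => INR n * zb_coef a b n / (INR n * legendre_coef n))).
  - exists 1%nat. intros n Hn. assert (Hn' : 0 < INR n) by (apply lt_0_INR; lia).
    pose proof (legendre_coef_bounds n). field. lra.
  - replace (PI / Beta a b) with (/ Beta a b / / PI) by (field; lra).
    apply is_lim_seq_div'.
    + apply zb_coef_limit; assumption.
    + apply wallis_limit.
    + apply Rinv_neq_0_compat; lra.
Qed.

Lemma legendre_coef_0 : legendre_coef 0 = 1.
Proof. unfold legendre_coef. simpl. field. Qed.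

Lemma zb_coef_0 (a b : R) : zb_coef a b 0 = 1.
Proof. unfold zb_coef. simpl. field. Qed.

(** If a+b <= 4ab <= 1, then (a+b)^2 >= 4ab >= a+b forces a+b >= 1, hence
    equality everywhere and a = b = 1/2.  Outside that point the constant
    term is therefore negative, and the slope is not positive. *)
Lemma D1_gap (a b t : R) :
  (a, b) <> (1 / 2, 1 / 2) -> D1 a b -> 0 <= t ->
  (a * b - 1 / 4) * t + (a * b - (a + b) / 4) < 0.
Proof.
  intros Hne (Ha & Hb & Hab) Ht.
  assert (Hsq := pow2_ge_0 (a - b)).
  assert (H0 : 4 * (a * b) < a + b).
  { apply Rnot_le_lt. intros H.
    assert (Hs : 1 <= a + b) by nra.
    assert (a + b = 1) by lra. assert (a - b = 0) by nra.
    apply Hne. f_equal; lra. }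
  nra.
Qed.

(** Here 4ab >= a+b, so (a+b)^2 >= a+b, a+b >= 1 and 4ab >= 1; equality in the last
    one would force a = b = 1/2.  Thus the slope is positive, but the constant
    term vanishes when 1/a + 1/b = 4. *)
Lemma D2_gap (a b t : R) :
  (a, b) <> (1 / 2, 1 / 2) -> D2 a b -> 0 <= t ->
  0 <= (a * b - 1 / 4) * t + (a * b - (a + b) / 4) /\
  (0 < t -> 0 < (a * b - 1 / 4) * t + (a * b - (a + b) / 4)).
Proof.
  intros Hne (Ha & Hb & Hab) Ht.
  assert (H : a + b <= 4 * (a * b)).
  { replace (1 / a + 1 / b) with ((a + b) / (a * b)) in Hab by (field; lra).
    assert (0 < a * b) by (apply Rmult_lt_0_compat; lra).
    apply (Rle_div_l (a + b) 4 (a * b)) in Hab; lra. }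
  assert (Hsq := pow2_ge_0 (a - b)).
  assert (Hs : 1 <= a + b) by nra.
  assert (H0 : 1 / 4 < a * b).
  { apply Rnot_le_lt. intros H0. assert (a + b = 1) by lra. assert (a - b = 0) by nra.
    apply Hne. f_equal; lra. }
  split; [nra|]. intros Ht0. nra.
Qed.

Lemma D1_step (a b : R) (n : nat) :
  (a, b) <> (1 / 2, 1 / 2) -> D1 a b ->
  zb_coef a b (S n) * legendre_coef n < zb_coef a b n * legendre_coef (S n).
Proof.
  intros Hne HD. destruct (HD) as (Ha & Hb & _).
  pose proof (D1_gap a b (INR n) Hne HD (pos_INR n)) as Hgap.
  pose proof (zb_coef_weight_pos a b n Ha Hb).
  pose proof (zb_coef_cross a b n Ha Hb). nra.
Qed.

Lemma D2_step (a b : R) (n : nat) :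
  (a, b) <> (1 / 2, 1 / 2) -> D2 a b ->
  legendre_coef (S n) * zb_coef a b n <= legendre_coef n * zb_coef a b (S n) /\
  ((0 < n)%nat ->
   legendre_coef (S n) * zb_coef a b n < legendre_coef n * zb_coef a b (S n)).
Proof.
  intros Hne HD. destruct (HD) as (Ha & Hb & _).
  destruct (D2_gap a b (INR n) Hne HD (pos_INR n)) as [Hle Hlt].
  pose proof (zb_coef_weight_pos a b n Ha Hb).
  pose proof (zb_coef_cross a b n Ha Hb).
  split; [nra|]. intros Hn. specialize (Hlt (lt_0_INR n Hn)). nra.
Qed.

(** * The two inequalities *)

Lemma landen_ratio_D1 (a b r : R) :
  (a, b) <> (1 / 2, 1 / 2) -> D1 a b -> 0 < r < 1 ->
  1 < landen_ratio a b r < Beta a b / PI.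
Proof.
  intros Hne HD Hr. destruct (HD) as (Ha & Hb & _).
  pose proof PI_RGT_0 as HPI. pose proof (Beta_pos a b Ha Hb) as HB.
  assert (Hq : forall n, 0 < legendre_coef n) by apply legendre_coef_bounds.
  assert (Hstep : forall n, zb_coef a b (S n) * legendre_coef n
                            <= zb_coef a b n * legendre_coef (S n))
    by (intros; left; apply D1_step; assumption).
  assert (Hlim := coef_ratio_limit a b Ha Hb).
  assert (H0 : zb_coef a b 0 = legendre_coef 0)
    by (rewrite zb_coef_0, legendre_coef_0; reflexivity).
  assert (Hp : forall n, 0 < zb_coef a b n <= 1).
  { intros n. split; [apply zb_coef_pos; assumption|].
    pose proof (coef_ratio_bounds _ _ _ Hq Hstep Hlim H0 n).
    pose proof (legendre_coef_bounds n). lra. }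
  assert (Ht := landen_bounds r ltac:(lra)).
  destruct (power_series_comparison _ _ _ 1 1 (r ^ 2) (landen r) 0
              (sqr_lt_landen r Hr) (proj2 Ht) Hp legendre_coef_bounds
              Hstep (D1_step a b 0 Hne HD) Hlim H0) as (Hmono & Hs & Hl).
  assert (HL := landen_identity r Hr). unfold legendre_P in HL.
  assert (HA : 0 < PSeries (zb_coef a b) (landen r)).
  { apply PSeries_pos; [apply Hp | lra |].
    apply (ex_pseries_bounded _ _ _ Hp). pose proof (sqr_lt_landen r Hr). lra. }
  assert (HC : 0 < PSeries legendre_coef (r ^ 2)).
  { pose proof (legendre_P_ge_1 (r ^ 2) (sqr_bounds r ltac:(lra))).
    unfold legendre_P in *. lra. }
  change (landen_ratio a b r) with
    ((1 + r) * PSeries (zb_coef a b) (r ^ 2) / PSeries (zb_coef a b) (landen r)).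
  split.
  - apply (Rlt_div_r _ _ (PSeries (zb_coef a b) (landen r))); [exact HA|].
    apply (Rmult_lt_reg_r (PSeries legendre_coef (r ^ 2))); [exact HC|].
    rewrite <- HL in Hmono. lra.
  - apply (Rlt_div_l _ _ (PSeries (zb_coef a b) (landen r))); [exact HA|].
    apply (Rmult_lt_reg_l (PI / Beta a b)); [apply Rdiv_lt_0_compat; lra|].
    replace (PI / Beta a b * (Beta a b / PI * PSeries (zb_coef a b) (landen r)))
      with (PSeries (zb_coef a b) (landen r)) by (field; lra).
    eapply Rlt_trans; [|exact Hl]. rewrite <- HL.
    apply Rmult_lt_compat_l; [apply Rdiv_lt_0_compat; lra|].
    apply Rmult_lt_compat_l; lra.
Qed.

Lemma landen_ratio_D2 (a b r : R) :
  (a, b) <> (1 / 2, 1 / 2) -> D2 a b -> 0 < r < 1 ->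
  Beta a b / PI < landen_ratio a b r < 1.
Proof.
  intros Hne HD Hr. destruct (HD) as (Ha & Hb & _).
  pose proof PI_RGT_0 as HPI. pose proof (Beta_pos a b Ha Hb) as HB.
  assert (Hc : 0 < Beta a b / PI) by (apply Rdiv_lt_0_compat; lra).
  assert (Hq : forall n, 0 < zb_coef a b n) by (intros; apply zb_coef_pos; assumption).
  assert (Hstep : forall n, legendre_coef (S n) * zb_coef a b n
                            <= legendre_coef n * zb_coef a b (S n))
    by (intros; apply D2_step; assumption).
  assert (Hlim : is_lim_seq (fun n => legendre_coef n / zb_coef a b n) (Beta a b / PI)).
  { apply (is_lim_seq_ext (fun n => / (zb_coef a b n / legendre_coef n))).
    - intros n. specialize (Hq n). pose proof (legendre_coef_bounds n). field. lra.
    - replace (Finite (Beta a b / PI)) with (Rbar_inv (PI / Beta a b))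
        by (simpl; f_equal; field; lra).
      apply is_lim_seq_inv; [exact (coef_ratio_limit a b Ha Hb)|].
      intros E. inversion E as [E'].
      assert (0 < PI / Beta a b) by (apply Rdiv_lt_0_compat; lra). lra. }
  assert (H0 : legendre_coef 0 = zb_coef a b 0)
    by (rewrite zb_coef_0, legendre_coef_0; reflexivity).
  assert (Hq' : forall n, 0 < zb_coef a b n <= 1 / (Beta a b / PI)).
  { intros n. split; [apply Hq|].
    pose proof (coef_ratio_bounds _ _ _ Hq Hstep Hlim H0 n).
    pose proof (legendre_coef_bounds n).
    apply (Rle_div_r _ 1 (Beta a b / PI)); lra. }
  assert (Ht := landen_bounds r ltac:(lra)).
  (* Index 1, not 0: on the boundary 1/a + 1/b = 4 the first two coefficients
     of the two series have the same ratio. *)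
  destruct (power_series_comparison _ _ _ _ _ (r ^ 2) (landen r) 1
              (sqr_lt_landen r Hr) (proj2 Ht) legendre_coef_bounds Hq'
              Hstep (proj2 (D2_step a b 1 Hne HD) ltac:(lia)) Hlim H0)
    as (Hmono & Hs & Hl).
  assert (HL := landen_identity r Hr). unfold legendre_P in HL.
  assert (HA : 0 < PSeries (zb_coef a b) (landen r)).
  { apply PSeries_pos; [apply Hq | lra |].
    apply (ex_pseries_bounded _ _ _ Hq'). pose proof (sqr_lt_landen r Hr). lra. }
  assert (HC : 0 < PSeries legendre_coef (r ^ 2)).
  { pose proof (legendre_P_ge_1 (r ^ 2) (sqr_bounds r ltac:(lra))).
    unfold legendre_P in *. lra. }
  change (landen_ratio a b r) with
    ((1 + r) * PSeries (zb_coef a b) (r ^ 2) / PSeries (zb_coef a b) (landen r)).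
  split.
  - apply (Rlt_div_r _ _ (PSeries (zb_coef a b) (landen r))); [exact HA|].
    eapply Rlt_trans; [exact Hl|]. rewrite <- HL.
    apply Rmult_lt_compat_l; lra.
  - apply (Rlt_div_l _ _ (PSeries (zb_coef a b) (landen r))); [exact HA|].
    apply (Rmult_lt_reg_r (PSeries legendre_coef (r ^ 2))); [exact HC|].
    rewrite <- HL in Hmono. lra.
Qed.

Theorem theorem2p2 :
  forall a b : R, (a, b) <> (1 / 2, 1 / 2) ->
    (D1 a b -> forall r : R, 0 < r < 1 ->
       1 < landen_ratio a b r < Beta a b / PI) /\
    (D2 a b -> forall r : R, 0 < r < 1 ->
       Beta a b / PI < landen_ratio a b r < 1).
Proof.
  intros a b Hne. split; intros HD r Hr.
  - apply landen_ratio_D1; assumption.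
  - apply landen_ratio_D2; assumption.
Qed.
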